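(* For every integer $k\ge 3$, the number of nonisomorphic $k$-polyominoes consisting of $3$ cells is $$a_k(3)=\left\lfloor\frac{k}{2}\right\rfloor-\left\lfloor\frac{k+5}{6}\right\rfloor+1.$$
   Context: A $k$-polyomino with $n$ cells is a union of $n$ congruent regular $k$-gons (cells) with pairwise disjoint interiors, joined edge-to-edge (two cells are neighbors if they share a full edge), such that the neighbor graph is connected. Two $k$-polyominoes are isomorphic if one is the image of the other under an isometry of the plane (rotations and reflections allowed). $a_k(n)$ denotes the number of isomorphism classes of $k$-polyominoes with $n$ cells. *)

(* Defs.v *)
From mathcomp Require Export all_boot all_order all_algebra.
From mathcomp Require Export all_classical all_reals all_analysis.

Set Implicit Arguments.
Unset Strict Implicit.
Unset Printing Implicit Defensive.

Import Order.TTheory GRing.Theory Num.Theory.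
Import numFieldNormedType.Exports.

Local Open Scope classical_set_scope.
Local Open Scope ring_scope.

Section Polyominoes.
Context {R : realType}.

(* The norm that the library puts on [R * R] is the sup norm, so the Euclidean
   distance is spelled out; the two induce the same topology, hence the
   interior [A°] of a set of points is the usual one. *)
Definition dist (p q : R * R) : R :=
  Num.sqrt ((p.1 - q.1) ^+ 2 + (p.2 - q.2) ^+ 2).

(* Distance-preserving self-maps of the Euclidean plane are automatically
   bijective. *)
Definition plane_isometry (f : R * R -> R * R) : Prop :=
  forall p q, dist (f p) (f q) = dist p q.

Definition conv_hull (A : set (R * R)) : set (R * R) :=
  smallest (fun B => convex_set (B : set (convex_lmodType (R * R)%type))) A.

(* A cell is given by its center and by the direction of one of its vertices.
   The number k of vertices and the circumradius r are parameters: all cells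
   are congruent to one fixed regular k-gon, since otherwise rescaling alone
   would yield infinitely many isomorphism classes. *)
Record cell := Cell { center : R * R; angle : R }.

Definition vertex (k : nat) (r : R) (x : cell) (j : nat) : R * R :=
  let t := angle x + 2 * pi * j%:R / k%:R in
  ((center x).1 + r * cos t, (center x).2 + r * sin t).

Definition region k r x : set (R * R) :=
  conv_hull [set vertex k r x j | j in `I_k].

(* [vertex k r x] is k-periodic, so [edge k r x k.-1] is the closing edge. *)
Definition edge k r x (j : nat) : set (R * R) :=
  conv_hull [set vertex k r x j; vertex k r x j.+1].

Definition share_edge k r (x y : cell) : Prop :=
  exists i j : 'I_k, edge k r x i = edge k r y j.

Definition neighbors k r n (c : 'I_n -> cell) : rel 'I_n :=
  fun i j => (i != j) && `[< share_edge k r (c i) (c j) >].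

Definition is_polyomino k r n (P : set (R * R)) : Prop :=
  exists c : 'I_n -> cell,
    [/\ forall i j, i != j ->
          (region k r (c i))° `&` (region k r (c j))° = set0,
        forall i j, connect (neighbors k r c) i j
      & P = \bigcup_i region k r (c i)].

Definition isomorphic (P Q : set (R * R)) : Prop :=
  exists2 f, plane_isometry f & f @` P = Q.

Definition polyomino_classes k r n : set (set (set (R * R))) :=
  [set [set Q | is_polyomino k r n Q /\ isomorphic P Q]
    | P in [set P | is_polyomino k r n P]].

End Polyominoes.

(* Main.v *)
(* A polyomino with three cells has a middle cell m, and its two other cells
   are the mirror images of m in two of its edges. If the edges are d steps
   apart (d <= k / 2), a rigid motion brings the polyomino to a standard form
   depending on d only. With x = pi / k and apothem a = r cos x, the centers of
   the outer cells are 4 a sin (d x) apart.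
   - If 6 d < k this is less than 2 a and the inscribed discs overlap. If
     k <= 6 d, the symmetry axis of the polyomino separates the outer cells:
     this amounts to sin (j x) <= 2 cos x sin (d x) for all j of the parity of
     d + 1.
   - The diameter of the polyomino lies between 4 a sin (d x) + 2 a and
     4 a sin (d x) + 2 r; for distinct d these ranges are disjoint.
   Hence the classes correspond to the d with k / 6 <= d <= k / 2. *)
Require Import Defs.
From mathcomp Require Import all_boot all_order all_algebra.
From mathcomp Require Import all_classical all_reals all_analysis.
From mathcomp Require Import ring lra zify.

Local Open Scope classical_set_scope.
Local Open Scope card_scope.

(** * Trigonometry *)

Section Trigonometry.
Set Implicit Arguments.
Unset Strict Implicit.
Unset Printing Implicit Defensive.
Import Order.TTheory GRing.Theory Num.Theory numFieldNormedType.Exports.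
Local Open Scope ring_scope.
Variable R : realType.
Implicit Types (u v t x : R) (k d n : nat).

Lemma polar_form u v : exists t,
  u = Num.sqrt (u ^+ 2 + v ^+ 2) * cos t /\
  v = Num.sqrt (u ^+ 2 + v ^+ 2) * sin t.
Proof.
have uv0 : 0 <= u ^+ 2 + v ^+ 2 by rewrite addr_ge0 ?sqr_ge0.
set s := Num.sqrt _.
have s2 : s ^+ 2 = u ^+ 2 + v ^+ 2 by rewrite sqr_sqrtr.
have [s0|s0] := eqVneq s 0.
  exists 0; rewrite s0 !mul0r; move: s2; rewrite s0 => s2.
  by split; apply/eqP; rewrite -sqrf_eq0; apply/eqP; nra.
have sp : 0 < s by rewrite lt_neqAle eq_sym s0 sqrtr_ge0.
have u1 : -1 <= u / s <= 1.
  rewrite ler_pdivlMr// ler_pdivrMr//; apply/andP; split; nra.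
have sE : sin (acos (u / s)) = `|v| / s.
  rewrite sin_acos// -[`|v| / s]ger0_norm ?divr_ge0 ?(ltW sp)//.
  rewrite -sqrtr_sqr; congr Num.sqrt.
  rewrite !expr_div_n -normrX ger0_norm ?sqr_ge0// s2.
  by field; rewrite -s2 expf_neq0.
have cE : cos (acos (u / s)) = u / s by rewrite acosK// in_itv.
(* [acos] only yields directions in the upper half-plane; for negative [v] the angle is negated. *)
have [v0|v0] := leP 0 v.
  exists (acos (u / s)); rewrite cE sE ger0_norm//.
  by split; field.
exists (- acos (u / s)); rewrite cosN sinN cE sE ltr0_norm//.
by split; field.
Qed.

Lemma cosDnat t n : cos (t + 2 * pi * n%:R) = cos t.
Proof.
rewrite (_ : 2 * pi * n%:R = (pi *+ 2) *+ n); first exact: (periodicn (@cosD2pi R)).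
by rewrite -[RHS]mulr_natr -[pi *+ 2]mulr_natr; ring.
Qed.

Lemma sinDnat t n : sin (t + 2 * pi * n%:R) = sin t.
Proof.
rewrite (_ : 2 * pi * n%:R = (pi *+ 2) *+ n); first exact: (periodicn (@sinD2pi R)).
by rewrite -[RHS]mulr_natr -[pi *+ 2]mulr_natr; ring.
Qed.

Lemma le_cos_pi x t : 0 <= x -> x <= t -> t <= pi -> cos t <= cos x.
Proof.
rewrite le_eqVlt => /predU1P[<-|x0]; first by rewrite cos0 cos_le1.
rewrite le_eqVlt => /predU1P[->//|xt tpi]; apply/ltW.
by rewrite ltr_cos// in_itv/=; apply/andP; split; lra.
Qed.

Lemma le_sin_pihalf x t : 0 <= x -> x <= t -> t <= pi / 2 -> sin x <= sin t.
Proof.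
move=> x0; rewrite le_eqVlt => /predU1P[->//|xt tpi]; apply/ltW.
have p0 := @pi_gt0 R.
by rewrite ltr_sin// in_itv/=; apply/andP; split; lra.
Qed.

(** An odd multiple of pi / k stays at least pi / k away from every multiple of 2 pi. Geometrically,
    no vertex of a regular k-gon lies beyond the line through one of its edges. *)
Lemma cos_odd_le k n : (0 < k)%N ->
  cos ((2 * n + 1)%:R * (pi / k%:R)) <= cos (pi / k%:R) :> R.
Proof.
move=> k0; have kR : 0 < k%:R :> R by rewrite ltr0n.
set x := pi / k%:R.
have x0 : 0 < x by rewrite divr_gt0 ?pi_gt0.
have kx : k%:R * x = pi by rewrite /x; field; rewrite gt_eqF.
rewrite (divn_eq n k) (_ : _ * x = (2 * (n %% k) + 1)%:R * x + 2 * pi * (n %/ k)%:R); last first.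
  by rewrite -kx !(natrM, natrD); ring.
rewrite cosDnat; have := ltn_pmod n k0; move: (n %% k)%N => m mk.
have mR : m%:R + 1 <= k%:R :> R by rewrite natr1 ler_nat.
have m0 : 0 <= m%:R :> R by rewrite ler0n.
rewrite natrD natrM; have [h|h] := leP ((2 * m%:R + 1) * x) pi.
  by apply: le_cos_pi => //; nra.
(* Past pi, the angle is replaced by its difference from 2 pi. *)
rewrite -[leLHS]cosN -(cosDnat _ 1); apply: le_cos_pi; nra.
Qed.

(** By the triple angle formula, s = sin (pi / 6) satisfies 3 s - 4 s ^ 3 = 1, which factors as (s +
    1) (2 s - 1) ^ 2 = 0. *)
Lemma sin_pi6 : sin (pi / 6) = 1 / 2 :> R.
Proof.
have p0 := @pi_gt0 R.
set y := pi / 6; have h := cos2Dsin2 y.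
have s0 : 0 < sin y by apply: sin_gt0_pi; rewrite /y; apply/andP; split; lra.
have : sin (y + (y + y)) = 1.
  by rewrite (_ : y + (y + y) = pi / 2) ?sin_pihalf// /y; field.
rewrite !sinD !cosD => h3.
have : (sin y + 1) * (2 * sin y - 1) ^+ 2 = 0.
  have c2 : cos y ^+ 2 = 1 - sin y ^+ 2 by lra.
  have -> : (sin y + 1) * (2 * sin y - 1) ^+ 2 = 1 - (3 * sin y * (1 - sin y ^+ 2) - sin y ^+ 3) by ring.
  by rewrite -c2 -[X in X - _]h3; ring.
move/eqP; rewrite mulf_eq0 gt_eqF/=; last lra.
by rewrite sqrf_eq0 => /eqP; lra.
Qed.

Lemma cos_pi3 : cos (pi / 3) = 1 / 2 :> R.
Proof.
by rewrite -sin_pi6 -[RHS]cosBpihalf -[LHS]cosN; congr cos; field.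
Qed.

Lemma sin_mvt u v : u <= v ->
  exists2 c, u <= c <= v & sin v - sin u = cos c * (v - u).
Proof.
move=> uv.
have sin_cont : {within `[u, v], continuous (@sin R)}.
  by apply: continuous_subspaceT; exact: continuous_sin.
have [c cuv ->] := MVT_segment uv (fun x _ => is_derive_sin x) sin_cont.
by exists c; first by move: cuv; rewrite in_itv.
Qed.

Lemma sin_le x : 0 <= x -> sin x <= x.
Proof.
move=> x0; have [c _] := sin_mvt x0; rewrite sin0 !subr0 => ->.
by have := cos_le1 c; nra.
Qed.

(** The chord slopes on both sides of [x] are values of the cosine, which decreases on [0, pi]. *)
Lemma sin_concave u x v : 0 <= u -> u <= x -> x <= v -> v <= pi ->
  (v - x) * sin u + (x - u) * sin v <= (v - u) * sin x.
Proof.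
move=> u0 ux xv vpi.
have [c /andP[c1 c2] h1] := sin_mvt ux.
have [e /andP[e1 e2] h2] := sin_mvt xv.
have ce : cos e <= cos c by apply: le_cos_pi; lra.
have h3 : (x - u) * (v - x) * cos e <= (x - u) * (v - x) * cos c.
  by apply: ler_wpM2l => //; apply: mulr_ge0; lra.
have h4 : (v - x) * (sin x - sin u) = (x - u) * (v - x) * cos c.
  by rewrite h1; ring.
have h5 : (x - u) * (sin v - sin x) = (x - u) * (v - x) * cos e.
  by rewrite h2; ring.
nra.
Qed.

(* This is [cos y >= 1 - y ^+ 2 / 2] at [y = pi / k], with [pi < 4]. *)
Lemma cos_pik_sqr_ge k : (0 < k)%N -> k%:R ^+ 2 - 8 <= k%:R ^+ 2 * cos (pi / k%:R) :> R.
Proof.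
move=> k0; have kR : 0 < k%:R :> R by rewrite ltr0n.
have p4 : pi < 4 :> R by have := @pihalf_lt2 R; lra.
have p0 := @pi_gt0 R.
(* Half of pi / k, so that the cosine becomes 1 - 2 sin y ^ 2, with k sin y <= k y = pi / 2 <= 2. *)
set y : R := pi / k%:R / 2.
have -> : pi / k%:R = y + y :> R by rewrite /y; field; rewrite gt_eqF.
have y0 : 0 <= y by rewrite /y divr_ge0// divr_ge0// ltW.
have kyE : k%:R * y = pi / 2 by rewrite /y; field; rewrite gt_eqF.
have ky : k%:R * y <= 2 by lra.
have s1 : k%:R * sin y <= 2.
  by apply: le_trans ky; rewrite ler_pM2l//; exact: sin_le.
have s0 : 0 <= k%:R * sin y.
  apply: mulr_ge0; first exact: ltW.
  apply: sin_ge0_pi; rewrite y0 /=.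
  have k1 : 1 <= k%:R :> R by rewrite ler1n.
  nra.
have c2 := cos2sin2 y.
rewrite cosD -!expr2 c2.
have -> : k%:R ^+ 2 * (1 - sin y ^+ 2 - sin y ^+ 2) = k%:R ^+ 2 - 2 * (k%:R * sin y) ^+ 2 by ring.
nra.
Qed.

(* The sine is bounded below by its chord on [0, pi / 6] when d = 2, and by its
   chord on [pi / 6, pi / 2] when d >= 3. *)
Lemma separation_ineq k d : (2 <= d)%N -> (2 * d <= k)%N -> (k < 6 * d)%N ->
  1 <= 2 * cos (pi / k%:R) * sin (d%:R * (pi / k%:R)) :> R.
Proof.
move=> d2 dk k6d; have p0 := @pi_gt0 R.
have k0 : (0 < k)%N by lia.
have kR : 0 < k%:R :> R by rewrite ltr0n.
set x := pi / k%:R; have kx : k%:R * x = pi by rewrite /x; field; rewrite gt_eqF.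
have x0 : 0 < x by rewrite divr_gt0.
have [dE|d3] := eqVneq d 2%N.
  subst d.
  have k4 : 4 <= k%:R :> R by rewrite (ler_nat _ 4).
  have k11 : k%:R <= 11 :> R by rewrite (ler_nat _ _ 11).
  (* The chord on [0, pi / 6] has slope 3 / pi, so sin x >= 3 / k, and k <= 11. *)
  have s1 : 3 / 11 <= sin x.
    have [h|h] := leP (pi / 6) x.
      apply: (@le_trans _ _ (sin (pi / 6))); first by rewrite sin_pi6; lra.
      by apply: le_sin_pihalf; nra.
    have := @sin_concave 0 x (pi / 6); rewrite sin0 sin_pi6 => /(_ (lexx _)).
    by move=> /(_ (ltW x0) (ltW h)) => /(_ ltac:(lra)) ?; nra.
  have cs : sin x <= cos x.
    by rewrite -cosBpihalf -cosN; apply: le_cos_pi; nra.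
  have c2 := cos2sin2 x.
  have -> : 2%:R * x = x + x by ring.
  (* With s = sin x this is 4 s (1 - s ^ 2), whose value at s = 3 / 11 is 1344 / 1331, just above 1.
     The upper bound on s comes from sin x <= cos x. *)
  rewrite sinD (_ : 2 * cos x * _ = 4 * (cos x ^+ 2 * sin x)); last by ring.
  have s2 : sin x ^+ 2 <= 1 / 2 by nra.
  have [h|h] := leP (1 / 2) (sin x); first by nra.
  by rewrite c2; nra.
have {}d3 : (3 <= d)%N by lia.
have d3R : 3 <= d%:R :> R by rewrite (ler_nat _ 3).
have dkR : 2 * d%:R <= k%:R :> R by rewrite -natrM ler_nat.
have k6 : 6 <= k%:R :> R by rewrite (ler_nat _ 6); lia.
have k6dR : k%:R + 1 <= 6 * d%:R :> R by rewrite natr1 -natrM ler_nat.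
have s1 : (k%:R + 6 * d%:R) <= 4 * k%:R * sin (d%:R * x).
  have := @sin_concave (pi / 6) (d%:R * x) (pi / 2).
  rewrite sin_pi6 sin_pihalf.
  have h1 : pi / 6 <= d%:R * x by rewrite -kx; nra.
  have h2 : d%:R * x <= pi / 2 by rewrite -kx; nra.
  move=> /(_ ltac:(lra) h1 h2 ltac:(lra)) h.
  have : pi * (k%:R + 6 * d%:R) <= pi * (4 * k%:R * sin (d%:R * x)).
    have -> : pi * (k%:R + 6 * d%:R) = 12 * k%:R * ((pi / 2 - d%:R * x) * (1 / 2) + (d%:R * x - pi / 6) * 1).
      by rewrite /x; field; rewrite gt_eqF.
    have -> : pi * (4 * k%:R * sin (d%:R * x)) = 12 * k%:R * ((pi / 2 - pi / 6) * sin (d%:R * x)) by field.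
    by apply: ler_wpM2l => //; nra.
  by rewrite ler_pM2l.
have c1 := @cos_pik_sqr_ge k k0; rewrite -/x in c1.
have c3 : 2 * k%:R <= (k%:R + 6 * d%:R) * cos x.
  have : k%:R ^+ 2 * (2 * k%:R) <= k%:R ^+ 2 * ((k%:R + 6 * d%:R) * cos x).
    rewrite mulrCA; apply: (@le_trans _ _ ((k%:R + 6 * d%:R) * (k%:R ^+ 2 - 8))); last first.
      by rewrite mulrCA; apply: ler_wpM2l => //; nra.
    have k2 : 0 <= k%:R ^+ 2 - 8 :> R by nra.
    (* This suffices since k + 6 d = 2 k + (6 d - k). The factor 6 d - k is at least 1, and also at
       least 18 - k because d >= 3: at least 2 for k <= 16 and 8 for k <= 10. *)
    have h : 16 * k%:R <= (6 * d%:R - k%:R) * (k%:R ^+ 2 - 8) :> R; last by nra.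
    have [h|h] := leqP 17 k.
      have hR : 17 <= k%:R :> R by rewrite (ler_nat _ 17).
      by apply: (@le_trans _ _ (1 * (k%:R ^+ 2 - 8))); [nra|apply: ler_wpM2r => //; lra].
    have hR : k%:R <= 16 :> R by rewrite (ler_nat _ _ 16).
    have [h'|h'] := leP 10 (k%:R : R).
      by apply: (@le_trans _ _ (2 * (k%:R ^+ 2 - 8))); [nra|apply: ler_wpM2r => //; lra].
    by apply: (@le_trans _ _ (8 * (k%:R ^+ 2 - 8))); [nra|apply: ler_wpM2r => //; lra].
  by rewrite ler_pM2l// exprn_gt0.
have c0 : 0 <= cos x by nra.
nra.
Qed.

(** Serves the case d = 1 of the separation. Modulo 2 pi the angle is 0, 2 x, 4 x (where cos (2 x)
    <= 1 / 2 helps), or between 6 x >= pi and 2 pi, where the sine is nonpositive. *)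
Lemma sin_multiple_le_first k n : (3 <= k <= 6)%N ->
  sin ((2 * n)%:R * (pi / k%:R)) <= sin (2 * (pi / k%:R)) :> R.
Proof.
move=> /andP[k3 k6]; have p0 := @pi_gt0 R.
have kR : 0 < k%:R :> R by rewrite ltr0n; lia.
set x := pi / k%:R; have kx : k%:R * x = pi by rewrite /x; field; rewrite gt_eqF.
have x0 : 0 < x by rewrite divr_gt0.
have k3R : 3 <= k%:R :> R by rewrite (ler_nat _ 3).
have k6R : k%:R <= 6 :> R by rewrite (ler_nat _ _ 6).
have s0 : 0 <= sin (2 * x) by apply: sin_ge0_pi; apply/andP; split; nra.
rewrite (divn_eq n k) (_ : _ * x = (2 * (n %% k))%:R * x + 2 * pi * (n %/ k)%:R); last first.
  by rewrite -kx !(natrM, natrD); ring.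
rewrite sinDnat; have := @ltn_pmod n k ltac:(lia); move: (n %% k)%N => m mk.
have mR : m%:R + 1 <= k%:R :> R by rewrite natr1 ler_nat.
case: m mk mR => [|[|[|m]]] mk mR.
- by rewrite muln0 mul0r sin0.
- by rewrite muln1.
- rewrite (_ : _ * x = 2 * x + 2 * x); last by rewrite natrM; ring.
  rewrite sinD; have : cos (2 * x) <= 1 / 2.
    by rewrite -cos_pi3; apply: le_cos_pi; nra.
  nra.
- apply: le_trans s0; rewrite -[leLHS]opprK oppr_le0 -sinN.
  rewrite -(sinDnat _ 1); apply: sin_ge0_pi.
  have : 3 <= m.+3%:R :> R by rewrite (ler_nat _ 3).
  rewrite natrM; move: (m.+3%:R : R) mR => w mR w3.
  by apply/andP; split; nra.
Qed.

End Trigonometry.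

(** * Multiples of pi / k *)

Section Angles.
Set Implicit Arguments.
Unset Strict Implicit.
Unset Printing Implicit Defensive.
Import Order.TTheory GRing.Theory Num.Theory numFieldNormedType.Exports.
Local Open Scope ring_scope.
Variables (R : realType) (k : nat).
Hypothesis k3 : (3 <= k)%N.
Implicit Types (d m n : nat).
Local Notation x := (pi / k%:R : R).

Lemma kR_gt0 : 0 < k%:R :> R. Proof. by rewrite ltr0n; lia. Qed.

Lemma kR_neq0 : k%:R != 0 :> R. Proof. by rewrite gt_eqF ?kR_gt0. Qed.

Lemma mulk_pik : k%:R * x = pi. Proof. by field; exact: kR_neq0. Qed.

Lemma pik_gt0 : 0 < x. Proof. by rewrite divr_gt0 ?pi_gt0 ?kR_gt0. Qed.

Lemma pik_le_pi3 : x <= pi / 3.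
Proof.
have := mulk_pik; have := pik_gt0.
have : 3 <= k%:R :> R by rewrite (ler_nat _ 3).
by move: x => y *; nra.
Qed.

Lemma cos_pik_ge : 1 / 2 <= cos x.
Proof.
have h0 := pik_gt0; have h3 := pik_le_pi3; have p0 := @pi_gt0 R.
by rewrite -cos_pi3; apply: le_cos_pi; lra.
Qed.

Lemma sin_pik_gt0 : 0 < sin x.
Proof.
have h0 := pik_gt0; have h3 := pik_le_pi3; have p0 := @pi_gt0 R.
by apply: sin_gt0_pi; apply/andP; split; lra.
Qed.

(** Adding [n] full turns replaces the possibly negative m - n by the natural number m + (k - 1)
    n. *)
Lemma cos_odd_diff_le m n : cos ((2 * (m%:R - n%:R) + 1) * x) <= cos x.
Proof.
have k0 : (0 < k)%N by lia.
rewrite -(cosDnat _ n); apply: le_trans (cos_odd_le R (m + k.-1 * n) k0).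
rewrite le_eqVlt; apply/orP; left; apply/eqP; congr cos.
by rewrite !(natrD, natrM) -subn1 natrB//; field; exact: kR_neq0.
Qed.

(* If k = 6 d then d + 1 and k / 2 = 3 d have opposite parities, so the left-hand
   side is at most [cos x]; if k < 6 d and d >= 2, the right-hand side is at
   least 1. *)
Lemma sin_parity_le d m n : (0 < d)%N -> (2 * d <= k <= 6 * d)%N ->
  sin ((d%:R + 1 + 2 * (m%:R - n%:R)) * x) <= 2 * cos x * sin (d%:R * x).
Proof.
move=> d0 /andP[dk kd]; have k0 : (0 < k)%N by lia.
have [k6|k6] := eqVneq k (6 * d)%N.
  have dE : d%:R * x = pi / 6.
    by rewrite k6 natrM; field; rewrite pnatr_eq0 -lt0n.
  rewrite dE sin_pi6 (_ : 2 * cos x * (1 / 2) = cos x); last by field.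
  apply: le_trans (cos_odd_diff_le m (n + d)); rewrite -cosBpihalf.
  rewrite le_eqVlt; apply/orP; left; apply/eqP; congr cos.
  rewrite (_ : pi / 2 = 3 * (d%:R * x)); last by rewrite dE; field.
  by rewrite natrD; ring.
have [d1|d1] := eqVneq d 1%N.
  rewrite d1 mul1r (_ : 2 * cos x * sin x = sin (2 * x)); last first.
    by rewrite (_ : 2 * x = x + x) ?sinD; ring.
  have k36 : (3 <= k <= 6)%N by lia.
  apply: le_trans (sin_multiple_le_first R (m.+1 + k.-1 * n) k36).
  rewrite -(sinDnat _ n) le_eqVlt; apply/orP; left; apply/eqP; congr sin.
  by rewrite !(natrD, natrM) -subn1 natrB// -natr1; field; exact: kR_neq0.
apply: le_trans (sin_le1 _) _; apply: separation_ineq; lia.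
Qed.

Lemma sin_multiple_ge_half d : (2 * d <= k <= 6 * d)%N -> 1 / 2 <= sin (d%:R * x).
Proof.
move=> /andP[dk kd]; have h0 := pik_gt0; have p0 := @pi_gt0 R; have e := mulk_pik.
have dkR : 2 * d%:R <= k%:R :> R by rewrite -natrM ler_nat.
have kdR : k%:R <= 6 * d%:R :> R by rewrite -natrM ler_nat.
by rewrite -sin_pi6; apply: le_sin_pihalf; move: x h0 e => y h0 e; nra.
Qed.

Lemma sin_multiple_lt_half d : (6 * d < k)%N -> 0 <= sin (d%:R * x) < 1 / 2.
Proof.
move=> kd; have h0 := pik_gt0; have p0 := @pi_gt0 R; have e := mulk_pik.
have kdR : 6 * d%:R + 1 <= k%:R :> R by rewrite -natrM natr1 ler_nat.
have d0 : 0 <= d%:R :> R by [].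
rewrite -sin_pi6 sin_ge0_pi/=; last first.
  by move: x h0 e => y h0 e; apply/andP; split; nra.
by rewrite ltr_sin ?in_itv/=; move: x h0 e => y h0 e; rewrite ?in_itv/=; try (apply/andP; split); nra.
Qed.

(** Multiplied by 4 r, this keeps the diameter ranges of [d] and [d'] apart. With w = d' x, sin w -
    sin (w - x) is at least (sin w + cos w) (1 - cos x), hence at least 1 - cos x, and cos x > 1 / 2
    because d' >= 2 forces k >= 4. *)
Lemma sin_multiple_gap d d' : (0 < d)%N -> (d < d')%N -> (2 * d' <= k)%N ->
  (1 - cos x) / 2 < cos x * (sin (d'%:R * x) - sin (d%:R * x)).
Proof.
move=> d0 dd dk; have h0 := pik_gt0; have p0 := @pi_gt0 R; have e := mulk_pik.
have d0R : 1 <= d%:R :> R by rewrite (ler_nat _ 1).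
have ddR : d%:R + 1 <= d'%:R :> R by rewrite natr1 ler_nat.
have dkR : 2 * d'%:R <= k%:R :> R by rewrite -natrM ler_nat.
have c1 : 1 / 2 < cos x.
  rewrite -cos_pi3 ltr_cos ?in_itv/=; move: x h0 e => y h0 e; try (apply/andP; split); nra.
set w := d'%:R * x.
have w0 : 0 <= w <= pi / 2 by rewrite /w; move: x h0 e => y h0 e; apply/andP; split; nra.
have s1 : sin (d%:R * x) <= sin (w - x).
  by apply: le_sin_pihalf; rewrite /w; move: x h0 e => y h0 e; nra.
have sx := sin_pik_gt0; have h2 := cos2Dsin2 x; have h3 := cos2Dsin2 w.
have cx : cos x < 1 by nra.
have sw : 0 <= sin w by apply: sin_ge0_pi; lra.
have cw : 0 <= cos w by apply: cos_ge0_pihalf; lra.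
rewrite sinB in s1.
have q1 : 1 <= sin w + cos w by nra.
have q2 : 1 - cos x <= sin x by nra.
have q3 : 1 - cos x <= sin w - sin (d%:R * x).
  have : cos w * (1 - cos x) <= cos w * sin x by apply: ler_wpM2l.
  have : 1 * (1 - cos x) <= (sin w + cos w) * (1 - cos x) by apply: ler_wpM2r => //; lra.
  nra.
nra.
Qed.

End Angles.

(** * Hulls and motions of the plane *)

Section Plane.
Set Implicit Arguments.
Unset Strict Implicit.
Unset Printing Implicit Defensive.
Import Order.TTheory GRing.Theory Num.Theory numFieldNormedType.Exports.
Local Open Scope ring_scope.
Variable R : realType.
Implicit Types (p q c : R * R) (t s u : R) (A B : set (R * R)).

(** The radius [u] may be negative, which stands for the opposite direction. *)
Definition polar c u t : R * R := (c.1 + u * cos t, c.2 + u * sin t).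

(** The inner product with the unit vector in direction [t]; bounds on it describe half-planes. *)
Definition height t p : R := p.1 * cos t + p.2 * sin t.

Definition move c t p : R * R :=
  (c.1 + (cos t * p.1 - sin t * p.2), c.2 + (sin t * p.1 + cos t * p.2)).

Definition segment_point s p q : R * R :=
  (s * p.1 + (1 - s) * q.1, s * p.2 + (1 - s) * q.2).

Lemma point_ext p q : p.1 = q.1 -> p.2 = q.2 -> p = q.
Proof. by case: p q => [p1 p2] [q1 q2] /= -> ->. Qed.

Lemma polar0 c t : polar c 0 t = c.
Proof. by apply: point_ext; rewrite /= mul0r addr0. Qed.

Lemma polarDpi c u t : polar c u (t + pi) = polar c (- u) t.
Proof. by apply: point_ext; rewrite /= ?cosDpi ?sinDpi; ring. Qed.

Lemma polar_polar c u s t : polar (polar c u t) s t = polar c (u + s) t.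
Proof. by apply: point_ext; rewrite /=; ring. Qed.

Lemma polar_surj c p : exists2 u, 0 <= u & exists t, p = polar c u t.
Proof.
have [t [h1 h2]] := polar_form (p.1 - c.1) (p.2 - c.2).
exists (Num.sqrt ((p.1 - c.1) ^+ 2 + (p.2 - c.2) ^+ 2)); first exact: sqrtr_ge0.
by exists t; apply: point_ext; rewrite /= -?h1 -?h2; ring.
Qed.

Lemma height_polar t c u s : height t (polar c u s) = height t c + u * cos (s - t).
Proof. by rewrite /height cosB /=; ring. Qed.

Lemma heightDpi t p : height (t + pi) p = - height t p.
Proof. by rewrite /height cosDpi sinDpi; ring. Qed.

Lemma dist_polar c u t : dist (polar c u t) c = `|u|.
Proof.
rewrite /dist /= -sqrtr_sqr; congr Num.sqrt.
have h := cos2Dsin2 t.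
rewrite (_ : _ + _ = u ^+ 2 * (cos t ^+ 2 + sin t ^+ 2)); last by ring.
by rewrite h mulr1.
Qed.

Lemma distC p q : dist p q = dist q p.
Proof. by rewrite /dist; congr Num.sqrt; ring. Qed.

Lemma move_polar c t q u s : move c t (polar q u s) = polar (move c t q) u (s + t).
Proof. by apply: point_ext; rewrite /= ?cosD ?sinD; ring. Qed.

Lemma dist_move c t : plane_isometry (move c t).
Proof.
move=> p q; rewrite /dist /=; congr Num.sqrt.
have h := cos2Dsin2 t; set a := p.1 - q.1; set b := p.2 - q.2.
rewrite -[RHS]mul1r -h /a /b; ring.
Qed.

Lemma moveK c t : exists c', cancel (move c t) (move c' (- t)) /\
  cancel (move c' (- t)) (move c t).
Proof.
(* This is [- c] rotated by [- t]. *)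
exists (- (cos t * c.1 + sin t * c.2), - (cos t * c.2 - sin t * c.1)).
have h := cos2Dsin2 t.
split=> p; apply: point_ext; rewrite /= cosN sinN.
- by rewrite -[RHS]mul1r -h; ring.
- by rewrite -[RHS]mul1r -h; ring.
- rewrite [RHS](_ : _ = c.1 + (cos t ^+ 2 + sin t ^+ 2) * (p.1 - c.1)); last by rewrite h; ring.
  by ring.
- rewrite [RHS](_ : _ = c.2 + (cos t ^+ 2 + sin t ^+ 2) * (p.2 - c.2)); last by rewrite h; ring.
  by ring.
Qed.

(** * Convex hulls and interiors *)

Lemma sub_conv_hull A : A `<=` conv_hull A.
Proof. exact: sub_gen_smallest. Qed.

Lemma conv_hull_segment A s p q : 0 <= s -> s <= 1 ->
  conv_hull A p -> conv_hull A q -> conv_hull A (segment_point s p q).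
Proof.
move=> s0 s1 Ap Aq B [cB AB].
have := cB p q (Itv01 s0 s1); rewrite !inE => h.
exact: h (Ap B (conj cB AB)) (Aq B (conj cB AB)).
Qed.

(** The induction principle for hulls, with convexity spelled out in coordinates. *)
Lemma conv_hull_sub A B :
  (forall p q s, 0 <= s -> s <= 1 -> B p -> B q -> B (segment_point s p q)) ->
  A `<=` B -> conv_hull A `<=` B.
Proof.
move=> cB AB; apply: smallest_sub => // p q l; rewrite !inE => Bp Bq.
exact: (cB p q l%:num).
Qed.

Lemma conv_hull_subset A B : A `<=` B -> conv_hull A `<=` conv_hull B.
Proof.
move=> AB; apply: conv_hull_sub; first by move=> *; exact: conv_hull_segment.
by move=> p /AB; exact: sub_conv_hull.
Qed.

Lemma conv_hull_pair p q v : conv_hull [set p; q] v ->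
  exists2 s, 0 <= s <= 1 & v = segment_point s p q.
Proof.
suff: conv_hull [set p; q] `<=` [set v | exists2 s, 0 <= s <= 1 & v = segment_point s p q].
  by move=> h /h.
apply: conv_hull_sub; last first.
  move=> _ [->|->].
    by exists 1; [rewrite lexx ler01|apply: point_ext; rewrite /=; ring].
  by exists 0; [rewrite lexx ler01|apply: point_ext; rewrite /=; ring].
move=> _ _ s s0 s1 [a /andP[a0 a1] ->] [b /andP[b0 b1] ->].
exists (s * a + (1 - s) * b); last by apply: point_ext; rewrite /=; ring.
by apply/andP; split; nra.
Qed.

Lemma height_conv_hull t h A : (forall p, A p -> height t p <= h) ->
  forall p, conv_hull A p -> height t p <= h.
Proof.
move=> Ah; apply: conv_hull_sub => // p q s s0 s1 /= ph qh.
have -> : height t (segment_point s p q) = s * height t p + (1 - s) * height t q.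
  by rewrite /height /=; ring.
nra.
Qed.

Lemma move_conv_hull c t A : move c t @` conv_hull A = conv_hull (move c t @` A).
Proof.
have [c' [mK Km]] := moveK c t.
(* Proved for every motion, so that the inverse motion yields the other inclusion. *)
have sub c1 t1 B : move c1 t1 @` conv_hull B `<=` conv_hull (move c1 t1 @` B).
  move=> _ [p Bp <-]; move: p Bp; apply: conv_hull_sub.
    move=> p q s s0 s1 /= h1 h2.
    have -> : move c1 t1 (segment_point s p q) =
      segment_point s (move c1 t1 p) (move c1 t1 q).
      by apply: point_ext; rewrite /=; ring.
    exact: conv_hull_segment.
  by move=> p Bp; apply: sub_conv_hull; exists p.
apply/seteqP; split; first exact: sub.
move=> p hp; exists (move c' (- t) p); last exact: Km.
have /sub : (move c' (- t) @` conv_hull (move c t @` A)) (move c' (- t) p) by exists p.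
apply: conv_hull_subset => _ [_ [q Aq <-] <-]; by rewrite mK.
Qed.

(** A common interior point could be pushed up a little inside [A] and down a little inside [B],
    across the separating line. *)
Lemma interior_disjoint t h A B : (forall p, A p -> height t p <= h) ->
  (forall p, B p -> h <= height t p) -> A° `&` B° = set0.
Proof.
move=> hA hB; rewrite -subset0 => p [Ap Bp].
have /nbhs_ballP[e /= e0 he] : nbhs p (A `&` B) by apply: filterI.
(* The ball is one of the sup norm; both coordinates of the displacement are at most |u| in absolute
   value. *)
have h2 u : `|u| < e -> A (polar p u t) /\ B (polar p u t).
  move=> ue; apply: he; split; rewrite /= -ball_normE /= opprD addrA subrr sub0r normrN normrM.
    by apply: le_lt_trans ue; rewrite ler_piMr// cos_max.
  by apply: le_lt_trans ue; rewrite ler_piMr// sin_max.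
have [/hA + _] := h2 (e / 2) ltac:(rewrite gtr0_norm; lra).
have [_ /hB] := h2 (- (e / 2)) ltac:(rewrite normrN gtr0_norm; lra).
rewrite !height_polar subrr cos0; lra.
Qed.

(** The open Euclidean disc is open in the product topology, being the preimage of an open half-line
    under the continuous squared distance [f]. *)
Lemma interior_disc c u A : (forall s t, `|s| <= u -> A (polar c s t)) ->
  forall s t, `|s| < u -> A° (polar c s t).
Proof.
move=> hA s t su.
have u0 : 0 < u by apply: le_lt_trans su.
pose f p := (p.1 - c.1) ^+ 2 + (p.2 - c.2) ^+ 2.
have fA : [set p | f p < u ^+ 2] `<=` A.
  move=> p /=; have [v v0 [r ->]] := polar_surj c p.
  rewrite /f /=; have h := cos2Dsin2 r => fp; apply: hA; rewrite ger0_norm//.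
  have : v ^+ 2 < u ^+ 2.
    by rewrite -[X in X < _]mulr1 -h; apply: le_lt_trans fp; rewrite le_eqVlt; apply/orP; left; apply/eqP; ring.
  by nra.
have fc : continuous f.
  have f1 : continuous (fun p : R * R => p.1 - c.1).
    by move=> p; apply: cvgB; [exact: cvg_fst|exact: cvg_cst].
  have f2 : continuous (fun p : R * R => p.2 - c.2).
    by move=> p; apply: cvgB; [exact: cvg_snd|exact: cvg_cst].
  by move=> p; apply: cvgD; apply: cvgM; by [exact: f1|exact: f2].
apply: (filterS fA).
have fcst : f (polar c s t) < u ^+ 2.
  rewrite /f /=; have h := cos2Dsin2 t.
  rewrite (_ : _ + _ = s ^+ 2 * (cos t ^+ 2 + sin t ^+ 2)); last by ring.
  by rewrite h mulr1 -real_normK ?num_real//; have := normr_ge0 s; nra.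
exact: (fc (polar c s t) [set y | y < u ^+ 2] (lt_nbhsl fcst)).
Qed.

End Plane.

(** * Cells and their neighbors *)

Section Cells.
Set Implicit Arguments.
Unset Strict Implicit.
Unset Printing Implicit Defensive.
(* [Defs] is imported again because a [center] of mathcomp shadows the one of cells. *)
Import Defs Order.TTheory GRing.Theory Num.Theory numFieldNormedType.Exports.
Local Open Scope ring_scope.
Variables (R : realType) (k : nat) (r : R).
Hypotheses (k3 : (3 <= k)%N) (r0 : 0 < r).
Implicit Types (p q c : R * R) (t s u : R) (y z : @cell R) (d i j l : nat).
Local Notation x := (pi / k%:R : R).

(* Direction of the outer normal of edge j. *)
Definition normal y j : R := angle y + (2 * j%:R + 1) * x.

(* The mirror image of a regular k-gon in one of its edges is also its image under
   the point reflection in the midpoint of that edge; hence the angle [+ pi]. *)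
Definition neighbor y j : @cell R :=
  Cell (polar (center y) (2 * (r * cos x)) (normal y j)) (angle y + pi).

Lemma apothem_gt0 : 0 < r * cos x.
Proof. by apply: mulr_gt0 => //; have := cos_pik_ge R k3; lra. Qed.

Lemma vertexE y j : vertex k r y j = polar (center y) r (angle y + 2 * j%:R * x).
Proof.
by rewrite /vertex /polar (_ : 2 * pi * j%:R / k%:R = 2 * j%:R * x)//; ring.
Qed.

(** Vertex indices are natural numbers, so [- j] is traded for (k - 1) j, which is congruent to it
    modulo k. *)
Lemma cosDpik t i j : cos (t + 2 * (i%:R - j%:R) * x) = cos (t + 2 * (i + k.-1 * j)%:R * x).
Proof.
have k0 : (0 < k)%N by lia.
rewrite -(cosDnat _ j) natrD natrM -subn1 natrB//; congr cos; field.
exact: kR_neq0.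
Qed.

Lemma sinDpik t i j : sin (t + 2 * (i%:R - j%:R) * x) = sin (t + 2 * (i + k.-1 * j)%:R * x).
Proof.
have k0 : (0 < k)%N by lia.
rewrite -(sinDnat _ j) natrD natrM -subn1 natrB//; congr sin; field.
exact: kR_neq0.
Qed.

Lemma vertexDk y j l : vertex k r y (j + l * k) = vertex k r y j.
Proof.
have tE : angle y + 2 * (j + l * k)%:R * x = angle y + 2 * j%:R * x + 2 * pi * l%:R.
  by rewrite natrD natrM; field; exact: kR_neq0.
by rewrite !vertexE tE /polar cosDnat sinDnat.
Qed.

Lemma region_vertex y j : region k r y (vertex k r y j).
Proof.
apply: sub_conv_hull; exists (j %% k)%N; first by rewrite /= ltn_mod; lia.
by rewrite {2}(divn_eq j k) addnC vertexDk.
Qed.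

(** Cosine and sine together express equality of directions modulo 2 pi. One common vertex direction
    forces all others to agree, with indices shifted by i - j. *)
Lemma region_subset y z i j : center y = center z ->
  cos (angle y + 2 * j%:R * x) = cos (angle z + 2 * i%:R * x) ->
  sin (angle y + 2 * j%:R * x) = sin (angle z + 2 * i%:R * x) ->
  region k r y `<=` region k r z.
Proof.
move=> cE hc hs; apply: conv_hull_sub; first by move=> *; exact: conv_hull_segment.
move=> _ [l _ <-].
suff -> : vertex k r y l = vertex k r z (i + (l + k.-1 * j)) by exact: region_vertex.
have tE : angle z + 2 * (i + (l + k.-1 * j))%:R * x =
  (angle z + 2 * i%:R * x) + 2 * (l + k.-1 * j)%:R * x by rewrite natrD; ring.
have yE : angle y + 2 * l%:R * x = (angle y + 2 * j%:R * x) + 2 * (l%:R - j%:R) * x by ring.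
rewrite !vertexE cE yE tE /polar cosDpik sinDpik.
move: (angle y + _) (angle z + 2 * i%:R * x) hc hs => a b hc hs.
by rewrite (cosD a) (sinD a) (cosD b) (sinD b) hc hs.
Qed.

Lemma region_eq y z i j : center y = center z ->
  cos (angle y + 2 * j%:R * x) = cos (angle z + 2 * i%:R * x) ->
  sin (angle y + 2 * j%:R * x) = sin (angle z + 2 * i%:R * x) ->
  region k r y = region k r z.
Proof.
move=> cE hc hs; apply/seteqP; split; first exact: (region_subset cE hc hs).
exact: (region_subset (esym cE) (esym hc) (esym hs)).
Qed.

(* The ray in direction t crosses the edge between the vertices n and n + 1, whose
   normal makes an angle h with it, at distance [r * cos x / cos h]. *)
Lemma region_ray y t : exists2 u, r * cos x <= u & region k r y (polar (center y) u t).
Proof.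
have x0 := pik_gt0 R k3; have sx := sin_pik_gt0 R k3; have x3 := pik_le_pi3 R k3.
have p0 := @pi_gt0 R; have p2 := @pi_ge2 R.
(* [M] full turns bring [t] past [angle y], so that the number [n] of whole steps of 2 x between
   them is natural. *)
pose M := Num.bound `|angle y - t|.
have hM : angle y <= t + 2 * pi * M%:R.
  have := archi_boundP (normr_ge0 (angle y - t)); rewrite -/M => h.
  have := ler_norm (angle y - t); have : 0 <= M%:R :> R by [].
  nra.
pose w := (t + 2 * pi * M%:R - angle y) / (2 * x).
have w0 : 0 <= w by apply: divr_ge0; lra.
pose n := Num.truncn w; have /andP[n1 n2] := truncn_itv w0.
pose h := (2 * n%:R + 1) * x - (t + 2 * pi * M%:R - angle y).
have wE : t + 2 * pi * M%:R - angle y = 2 * x * w.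
  by rewrite [RHS]mulrC /w divfK// mulf_neq0// ?gt_eqF.
rewrite -/n -natr1 in n1 n2.
have h1 : - x <= h <= x by rewrite /h wE; apply/andP; split; nra.
have ch : 0 < cos h by apply: cos_gt0_pihalf; lra.
have s1 : 0 <= sin (x + h) by apply: sin_ge0_pi; lra.
have s2 : 0 <= sin (x - h) by apply: sin_ge0_pi; lra.
rewrite sinD in s1; rewrite sinB in s2.
exists (r * cos x / cos h).
  rewrite ler_pdivlMr//; have := cos_le1 h; have := apothem_gt0; nra.
pose g := angle y + 2 * n%:R * x + x.
have tE : t + 2 * pi * M%:R = g - h by rewrite /g /h; ring.
(* The edge is a tan x long on each side of its midpoint, and the ray meets it a tan h away from
   there, a being the apothem; hence the weight 1 / 2 + tan h / (2 tan x). *)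
have -> : polar (center y) (r * cos x / cos h) t =
  segment_point (1 / 2 + cos x * sin h / (2 * sin x * cos h))
    (vertex k r y n) (vertex k r y n.+1).
  rewrite !vertexE (_ : angle y + 2 * n%:R * x = g - x); last by rewrite /g; ring.
  rewrite (_ : angle y + 2 * n.+1%:R * x = g + x); last by rewrite /g -natr1; ring.
  move: g h tE ch {s1 s2 h1} => g h tE ch.
  apply: point_ext; rewrite /= -1?(cosDnat t M) -1?(sinDnat t M) tE !(cosB, cosD, sinB, sinD);
    by field; rewrite !gt_eqF.
have sc : 0 < 2 * sin x * cos h by apply: mulr_gt0 => //; lra.
apply: conv_hull_segment; [| |exact: region_vertex|exact: region_vertex].
  rewrite (_ : _ + _ = (sin x * cos h + cos x * sin h) / (2 * sin x * cos h)); last first.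
    by field; rewrite !gt_eqF.
  by apply: divr_ge0 => //; exact: ltW.
rewrite (_ : _ + _ = (sin x * cos h + cos x * sin h) / (2 * sin x * cos h)); last first.
  by field; rewrite !gt_eqF.
rewrite ler_pdivrMr//; lra.
Qed.

(** By convexity: the point lies between two points of the region on opposite rays, each at least an
    apothem away from the center. *)
Lemma region_disc y u t : `|u| <= r * cos x -> region k r y (polar (center y) u t).
Proof.
move=> ua; have a0 := apothem_gt0.
have [u1 h1 r1] := region_ray y t; have [u2 h2 r2] := region_ray y (t + pi).
move: ua; rewrite ler_norml => /andP[ua1 ua2].
have -> : polar (center y) u t = segment_point ((u + u2) / (u1 + u2))
    (polar (center y) u1 t) (polar (center y) u2 (t + pi)).
  by rewrite polarDpi; apply: point_ext; rewrite /=; field; rewrite gt_eqF//; lra.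
apply: conv_hull_segment => //.
  by apply: divr_ge0; lra.
by rewrite ler_pdivrMr; lra.
Qed.

Lemma region_interior y u t : `|u| < r * cos x -> (region k r y)° (polar (center y) u t).
Proof. by apply: interior_disc => s s'; exact: region_disc. Qed.

Lemma region_height y t p : region k r y p -> height t p <= height t (center y) + r.
Proof.
apply: height_conv_hull => _ [l _ <-]; rewrite vertexE height_polar lerD2l.
by rewrite ler_piMr// ?cos_le1// ltW.
Qed.

Lemma region_edge_height y j p : region k r y p ->
  height (normal y j) p <= height (normal y j) (center y) + r * cos x.
Proof.
apply: height_conv_hull => _ [l _ <-]; rewrite vertexE height_polar lerD2l.
rewrite ler_pM2l// -cosN (_ : - _ = (2 * (j%:R - l%:R) + 1) * x); first exact: cos_odd_diff_le.
by rewrite /normal; ring.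
Qed.

(** The line through the common edge separates the cells: edge [j] of the neighbor has the opposite
    normal. *)
Lemma disjoint_neighbor y j : (region k r y)° `&` (region k r (neighbor y j))° = set0.
Proof.
apply: (interior_disjoint (fun p => @region_edge_height y j p)) => p /(@region_edge_height _ j).
rewrite (_ : normal _ _ = normal y j + pi); last by rewrite /normal /=; ring.
rewrite !heightDpi /= height_polar subrr cos0; lra.
Qed.

Lemma disjoint_neighbors y d : (0 < d)%N -> (2 * d <= k <= 6 * d)%N ->
  (region k r (neighbor y 0))° `&` (region k r (neighbor y d))° = set0.
Proof.
move=> d0 dk; rewrite setIC.
(* Perpendicular to the bisector of the two edge normals, which is the symmetry axis. *)
pose t := normal y 0 + d%:R * x - pi / 2.
have sincos s : sin s = cos (s + (pi + pi / 2)).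
  by rewrite addrA cosDpihalf sinDpi opprK.
(* Used for neighbor [d] in direction [t] and for neighbor 0 in direction [t + pi]; both centers are
   2 a sin (d x) away from the axis. *)
have nb_height t' z : height t' (center z) = height t' (center y) - 2 * (r * cos x) * sin (d%:R * x) ->
    (forall l, cos (angle z + 2 * l%:R * x - t') <= 2 * cos x * sin (d%:R * x)) ->
    forall p, region k r z p -> height t' p <= height t' (center y).
  move=> zE hz; apply: height_conv_hull => _ [l _ <-]; rewrite vertexE height_polar zE.
  have : r * cos (angle z + 2 * l%:R * x - t') <= r * (2 * cos x * sin (d%:R * x)).
    by apply: ler_wpM2l => //; exact: ltW.
  lra.
apply: (@interior_disjoint _ t (height t (center y))); first apply: nb_height.
- rewrite /= height_polar -mulrN -cosDpihalf; congr (_ + _ * cos _).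
  by rewrite /t /normal; field; exact: kR_neq0.
- move=> l; rewrite (_ : cos _ = sin ((d%:R + 1 + 2 * (l%:R - d.+1%:R)) * x)).
    exact: sin_parity_le.
  rewrite sincos; congr cos; rewrite /t /normal /= -natr1; field; exact: kR_neq0.
move=> p /(nb_height (t + pi)); rewrite !heightDpi lerN2; apply.
- rewrite -!heightDpi /= height_polar -mulrN -cosDpihalf
    -[cos (d%:R * x + _)]cosN; congr (_ + _ * cos _).
  by rewrite /t /normal; field; exact: kR_neq0.
- move=> l; rewrite (_ : cos _ = sin ((d%:R + 1 + 2 * (0%:R - l%:R)) * x)).
    exact: sin_parity_le.
  rewrite -cosBpihalf -[RHS]cosN; congr cos; rewrite /t /normal /=; field; exact: kR_neq0.
Qed.

(** The centers of the neighbors lie on a circle of radius 2 a; this is its chord over the angle 2 d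
    x, perpendicular to the bisector. *)
Lemma neighbor_offset y i d : center (neighbor y (i + d)) =
  polar (center (neighbor y i)) (4 * (r * cos x) * sin (d%:R * x)) (normal y i + d%:R * x + pi / 2).
Proof.
set g := normal y i + d%:R * x.
have iE : normal y i = g - d%:R * x by rewrite /g; ring.
have dE : normal y (i + d) = g + d%:R * x by rewrite /g /normal natrD; ring.
apply: point_ext; rewrite /= dE iE ?cosDpihalf ?sinDpihalf; move: g {iE dE} => g.
  by rewrite (cosD g) (cosB g); ring.
by rewrite (sinD g) (sinB g); ring.
Qed.

(** Otherwise the midpoint of the two centers, at distance [u] < a from each, is interior to both
    inscribed discs. *)
Lemma disjoint_neighbors_le y i d : (2 * d <= k)%N ->
  (region k r (neighbor y i))° `&` (region k r (neighbor y (i + d)))° = set0 -> (k <= 6 * d)%N.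
Proof.
move=> dk dis; rewrite leqNgt; apply/negP => kd.
have /andP[s0 s1] := sin_multiple_lt_half R k3 kd; have a0 := apothem_gt0.
pose u := 2 * (r * cos x) * sin (d%:R * x).
have u0 : `|u| < r * cos x by rewrite ger0_norm /u; nra.
pose t := normal y i + d%:R * x + pi / 2.
have h1 := region_interior (neighbor y i) t u0.
have h2 : (region k r (neighbor y (i + d)))° (polar (center (neighbor y i)) u t).
  have := @region_interior (neighbor y (i + d)) (- u) t; rewrite normrN => /(_ u0).
  rewrite neighbor_offset polar_polar; congr (_ ° (polar _ _ _)).
  by rewrite /u; ring.
by have : set0 (polar (center (neighbor y i)) u t) by rewrite -dis.
Qed.

Lemma region_not_disjoint y : (region k r y)° `&` (region k r y)° <> set0.
Proof.
rewrite setIid => h.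
have : (region k r y)° (polar (center y) 0 0).
  by apply: region_interior; rewrite normr0 apothem_gt0.
by rewrite h.
Qed.

Lemma share_edge_sym y z : share_edge k r y z -> share_edge k r z y.
Proof. by move=> [i [j e]]; exists j, i. Qed.

Lemma share_edge_neighbor y j : (j < k)%N -> share_edge k r y (neighbor y j).
Proof.
move=> jk; exists (Ordinal jk), (Ordinal jk) => /=; rewrite /edge setUC.
(* The point reflection in the midpoint of edge [j] exchanges the vertices [j] and [j.+1]; [h] is
   applied to both orders. *)
have h l l' : l%:R + l'%:R = 2 * j%:R + 1 :> R ->
    cos ((l%:R - l'%:R) * x) = cos x -> vertex k r y l = vertex k r (neighbor y j) l'.
  move=> e hc; rewrite !vertexE /=; set g := normal y j.
  have lE : angle y + 2 * l%:R * x = g + (l%:R - l'%:R) * x.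
    by rewrite /g /normal -e; ring.
  have l'E : angle y + pi + 2 * l'%:R * x = g - (l%:R - l'%:R) * x + pi.
    by rewrite /g /normal -e; ring.
  rewrite lE l'E polarDpi; move: g {lE l'E} => g.
  apply: point_ext; rewrite /=.
    by rewrite (cosD g) (cosB g) hc; ring.
  by rewrite (sinD g) (sinB g) hc; ring.
rewrite (h j j.+1) 1?(h j.+1 j)// -?natr1; try ring.
  by congr cos; ring.
by rewrite -cosN; congr cos; ring.
Qed.

Definition tricell y i j := region k r y `|` region k r (neighbor y i) `|` region k r (neighbor y j).

(* All edges have the same length, so equal edges have the same endpoints p, q.
   Matched in the same order they give the same polygon, matched in the opposite
   order the neighbor. *)
Lemma share_edge_region y z : share_edge k r y z ->
  (region k r y)° `&` (region k r z)° = set0 ->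
  exists2 j, (j < k)%N & region k r z = region k r (neighbor y j).
Proof.
move=> [i [j e]] dis; exists i => //.
have sx := sin_pik_gt0 R k3.
set g := normal y i; set h := normal z j.
have iE : angle y + 2 * (i : nat)%:R * x = g - x by rewrite /g /normal; ring.
have i1E : angle y + 2 * (i : nat).+1%:R * x = g + x by rewrite /g /normal -natr1; ring.
have jE : angle z + 2 * (j : nat)%:R * x = h - x by rewrite /h /normal; ring.
have j1E : angle z + 2 * (j : nat).+1%:R * x = h + x by rewrite /h /normal -natr1; ring.
have gE : normal y i = g by [].
have := e; rewrite /edge !vertexE iE i1E jE j1E => e'.
clearbody g h.
set p := polar (center y) r (g - x) in e'; set q := polar (center y) r (g + x) in e'.
set p' := polar (center z) r (h - x) in e'; set q' := polar (center z) r (h + x) in e'.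
have [s1 s1I ps] : exists2 s, 0 <= s <= 1 & p = segment_point s p' q'.
  by apply: conv_hull_pair; rewrite -e'; apply: sub_conv_hull; left.
have [s2 s2I qs] : exists2 s, 0 <= s <= 1 & q = segment_point s p' q'.
  by apply: conv_hull_pair; rewrite -e'; apply: sub_conv_hull; right.
have hg := cos2Dsin2 g; have hh := cos2Dsin2 h.
have L1 : (p.1 - q.1) ^+ 2 + (p.2 - q.2) ^+ 2 = 4 * r ^+ 2 * sin x ^+ 2.
  rewrite /p /q /= !(cosD g) !(sinD g) !cosN !sinN.
  by rewrite -[RHS]mulr1 -[X in _ = _ * X]hg; ring.
have L2 : (p'.1 - q'.1) ^+ 2 + (p'.2 - q'.2) ^+ 2 = 4 * r ^+ 2 * sin x ^+ 2.
  rewrite /p' /q' /= !(cosD h) !(sinD h) !cosN !sinN.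
  by rewrite -[RHS]mulr1 -[X in _ = _ * X]hh; ring.
have L0 : 4 * r ^+ 2 * sin x ^+ 2 != 0.
  by rewrite !mulf_neq0 ?expf_neq0// gt_eqF.
have rs0 : r * sin x != 0 by rewrite mulf_neq0// gt_eqF.
(* Equal lengths force the parameters, both in [0, 1], to be 0 and 1 in some order. *)
have s12 : (s1 - s2) ^+ 2 = 1.
  apply: (mulIf L0); rewrite mul1r -[in RHS]L1 -L2 ps qs /=; ring.
have [[s1E s2E]|[s1E s2E]] : (s1 = 1 /\ s2 = 0) \/ (s1 = 0 /\ s2 = 1).
- move: s1I s2I => /andP[s10 s11] /andP[s20 s21].
  have [h0|h0] := leP 0 (s1 - s2); [left|right].
    have : s1 - s2 = 1 by nra.
    by split; lra.
  have : s1 - s2 = - 1 by nra.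
  by split; lra.
- exfalso; move: (congr1 fst ps) (congr1 snd ps) (congr1 fst qs) (congr1 snd qs).
  rewrite s1E s2E /p /q /p' /q' /= !(cosD, cosN, sinD, sinN).
  move=> {L1 L2 L0 s12 hg hh ps qs s1I s2I s1E s2E s1 s2 p q p' q' e'} e1 e2 e3 e4.
  have cE : cos g = cos h by apply: (mulfI rs0); lra.
  have sE : sin g = sin h by apply: (mulfI rs0); lra.
  apply: (@region_not_disjoint y); rewrite -[in X in _ `&` X°](_ : region k r z = region k r y)//.
  apply: (@region_eq _ _ i j).
  + by apply: point_ext; move: e1 e2; rewrite cE sE; lra.
  + by rewrite iE jE !cosB cE sE.
  + by rewrite iE jE !sinB cE sE.
- move: (congr1 fst ps) (congr1 snd ps) (congr1 fst qs) (congr1 snd qs).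
  rewrite s1E s2E /p /q /p' /q' /= !(cosD, cosN, sinD, sinN).
  move=> {L1 L2 L0 s12 hg hh ps qs s1I s2I s1E s2E s1 s2 p q p' q' e'} e1 e2 e3 e4.
  have cE : cos h = - cos g by apply: (mulfI rs0); lra.
  have sE : sin h = - sin g by apply: (mulfI rs0); lra.
  have nE : angle (neighbor y i) + 2 * (i : nat)%:R * x = g - x + pi by rewrite /= -iE; ring.
  apply: (@region_eq _ _ i j).
  + apply: point_ext; rewrite /= gE.
      by move: e1; rewrite cE sE; clear; lra.
    by move: e2; rewrite cE sE; clear; lra.
  + by rewrite nE jE cosDpi !cosB cE sE; ring.
  + by rewrite nE jE sinDpi !sinB cE sE; ring.
Qed.

End Cells.

(** * Polyominoes with three cells *)

Section Connectivity.
Import GRing.Theory.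
Local Open Scope ring_scope.

(** Take a neighbor [j0] of 0 and the third vertex [z]. Whichever of 0 and [j0] is adjacent to [z]
    is the middle. *)
Lemma connected_ord3 (e : rel 'I_3) : symmetric e -> irreflexive e ->
  (forall i j : 'I_3, connect e i j) ->
  exists m p q : 'I_3, [/\ p != q, e m p & e m q].
Proof.
move=> esym eirr econn.
have enb (i j : 'I_3) : i != j -> exists l : 'I_3, e i l.
  move=> ij; have /connectP[[|l s] /= h ljs] := econn i j.
    by rewrite ljs eqxx in ij.
  by move/andP: h => [h _]; exists l.
have neq (i j : 'I_3) : e i j -> i != j by apply: contraTneq => ->; rewrite eirr.
have [j0 e0] := enb 0 1 isT.
have j00 := neq _ _ e0.
have [z zP] : exists z : 'I_3, (z != 0) && (z != j0).
  have [->|j01] := eqVneq j0 1; first by exists (inord 2); rewrite -!val_eqE /= inordK.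
  by exists 1; apply/andP; split=> //; rewrite eq_sym.
have /andP[z0 zj0] := zP.
have [j ej] := enb z 0 z0; have zj := neq _ _ ej.
have [jE|jE] : j = 0 \/ j = j0.
- have [->|h] := eqVneq j 0; [by left|right; apply/val_inj].
  move: h zj z0 zj0 j00; rewrite -!val_eqE /=.
  by have := ltn_ord j; have := ltn_ord j0; have := ltn_ord z; lia.
- by exists 0, j0, z; rewrite eq_sym zj0 e0 -jE esym ej.
- by exists j0, 0, z; rewrite eq_sym z0 esym e0 -jE esym ej.
Qed.

End Connectivity.

(** * Standard forms, their diameters, and the count of classes *)

Section Tricells.
Set Implicit Arguments.
Unset Strict Implicit.
Unset Printing Implicit Defensive.
Import Defs Order.TTheory GRing.Theory Num.Theory numFieldNormedType.Exports.
Local Open Scope ring_scope.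
Local Open Scope classical_set_scope.
Variables (R : realType) (k : nat) (r : R).
Hypotheses (k3 : (3 <= k)%N) (r0 : 0 < r).
Implicit Types (p q c : R * R) (t s u : R) (y z : @cell R) (d i j l : nat).
Implicit Types (P Q : set (R * R)).
Local Notation x := (pi / k%:R : R).
Local Notation nb := (neighbor k r).
Local Notation tri := (tricell k r).

Definition move_cell c t y : @cell R := Cell (move c t (center y)) (angle y + t).

Lemma region_move c t y : region k r (move_cell c t y) = move c t @` region k r y.
Proof.
have vE j : vertex k r (move_cell c t y) j = move c t (vertex k r y j).
  by rewrite !vertexE move_polar; congr polar; rewrite /=; ring.
rewrite move_conv_hull /region; congr conv_hull.
apply/seteqP; split=> [_ [j jk <-]|_ [_ [j jk <-] <-]].
  by exists (vertex k r y j); [exists j|rewrite vE].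
by exists j => //; rewrite vE.
Qed.

Lemma neighbor_move c t y j : nb (move_cell c t y) j = move_cell c t (nb y j).
Proof.
rewrite /neighbor /move_cell /= move_polar; congr (Cell (polar _ _ _) _); last by ring.
by rewrite /normal /=; ring.
Qed.

Lemma tricell_move c t y i j : tri (move_cell c t y) i j = move c t @` tri y i j.
Proof. by rewrite /tricell !neighbor_move !region_move !image_setU. Qed.

(** Renumbers the vertices of [y] starting from [i], which leaves every region unchanged. *)
Lemma tricell_shift y i d : tri y i (i + d) = tri (Cell (center y) (angle y + 2 * i%:R * x)) 0 d.
Proof.
have nE j : region k r (nb y (i + j)) = region k r (nb (Cell (center y) (angle y + 2 * i%:R * x)) j).
  have aE : angle y + pi + 2 * i%:R * x = angle y + 2 * i%:R * x + pi + 2 * 0%:R * x by ring.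
  apply: (@region_eq _ _ _ k3 r0 _ _ 0 i) => /=; rewrite ?aE//.
  by congr polar; rewrite /normal /= natrD; ring.
rewrite /tricell -!nE addn0; congr (_ `|` _ `|` _).
have aE : angle y + 2 * i%:R * x = angle y + 2 * i%:R * x + 2 * 0%:R * x by ring.
by apply: (@region_eq _ _ _ k3 r0 _ _ 0 i) => /=; rewrite -?aE.
Qed.

Definition std_tricell d : set (R * R) := tri (Cell (0, 0) 0) 0 d.

Lemma tricell_std y i d : exists c t, tri y i (i + d) = move c t @` std_tricell d.
Proof.
exists (center y), (angle y + 2 * i%:R * x).
rewrite tricell_shift -tricell_move; congr (tricell _ _ _ _ _).
rewrite /move_cell /= add0r; congr Cell.
by apply: point_ext; rewrite /=; ring.
Qed.

Lemma neighborDk y i : nb y (i + k) = nb y i.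
Proof.
rewrite /neighbor; congr Cell; rewrite /polar.
have -> : normal k y (i + k) = normal k y i + 2 * pi * 1%:R.
  by rewrite /normal natrD; field; exact: kR_neq0.
by rewrite cosDnat sinDnat.
Qed.

Lemma tricellC y i j : tri y i j = tri y j i.
Proof. by rewrite /tricell setUAC. Qed.

Lemma polyomino3_tricell P : is_polyomino k r 3 P ->
  exists y i d, [/\ (2 * d <= k)%N, (k <= 6 * d)%N & P = tri y i (i + d)].
Proof.
move=> [c [dis conn PE]].
have nsym : symmetric (neighbors k r c).
  move=> i j; rewrite /neighbors eq_sym; congr (_ && _).
  by apply/idP/idP => /asboolP h; apply/asboolP; exact: share_edge_sym.
have nirr : irreflexive (neighbors k r c) by move=> i; rewrite /neighbors eqxx.
have [m [p [q [pq /andP[mp /asboolP smp] /andP[mq /asboolP smq]]]]] := connected_ord3 nsym nirr conn.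
have [i ik pE] := share_edge_region k3 r0 smp (dis _ _ mp).
have [j jk qE] := share_edge_region k3 r0 smq (dis _ _ mq).
have {}PE : P = tri (c m) i j.
  rewrite PE /tricell -pE -qE; apply/seteqP; split=> [v [l _ vl]|v [[vl|vl]|vl]].
  - have [lm|lm] := eqVneq l m; first by left; left; rewrite -lm.
    have [lp|lp] := eqVneq l p; first by left; right; rewrite -lp.
    right; rewrite (_ : q = l)//; apply/val_inj.
    move: pq mp mq lm lp; rewrite -!val_eqE /=.
    by have := ltn_ord p; have := ltn_ord q; have := ltn_ord m; have := ltn_ord l; lia.
  - by exists m.
  - by exists p.
  - by exists q.
have := dis _ _ pq; rewrite pE qE => {}dis.
exists (c m); move: (c m) PE dis => y {c conn nsym nirr m p q pq mp mq smp smq pE qE} PE dis.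
wlog ij : i j ik jk PE dis / (i <= j)%N.
  move=> W; have [ij|ij] := leqP i j; first exact: (W i j).
  by apply: (W j i) => //; [rewrite tricellC|rewrite setIC|exact: ltnW].
have [dk|dk] := leqP (2 * (j - i)) k.
  exists i, (j - i)%N; rewrite subnKC//; split=> //.
  by apply: (disjoint_neighbors_le k3 r0 (y := y) (i := i)) => //; rewrite subnKC.
(* If the edges are more than k / 2 steps apart, counting goes the other way round, from [j] to
   [i + k], which is edge [i] again. *)
have jE : (j + (k - (j - i)) = i + k)%N by lia.
exists j, (k - (j - i))%N; rewrite jE /tricell neighborDk -/(tri y j i) tricellC; split=> //; first by lia.
by apply: (disjoint_neighbors_le k3 r0 (y := y) (i := j)); [lia|rewrite jE neighborDk setIC].
Qed.

Lemma std_tricell_polyomino d : (2 * d <= k <= 6 * d)%N -> is_polyomino k r 3 (std_tricell d).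
Proof.
move=> dk; have d0 : (0 < d)%N by lia.
pose o : @cell R := Cell (0, 0) 0.
pose c (i : 'I_3) := nth o [:: o; nb o 0; nb o d] i.
have s01 : share_edge k r o (nb o 0) by apply: share_edge_neighbor => //; lia.
have s02 : share_edge k r o (nb o d) by apply: share_edge_neighbor => //; lia.
exists c; split.
- have h1 := disjoint_neighbor k3 r0 o 0.
  have h2 := disjoint_neighbor k3 r0 o d.
  have h3 := disjoint_neighbors k3 r0 o d0 dk.
  by case=> [[|[|[|]]]// ?] [[|[|[|]]]// ?] //= _; rewrite /c /= // setIC.
- have e0 (i : 'I_3) : connect (neighbors k r c) ord0 i /\ connect (neighbors k r c) i ord0.
    case: i => [[|[|[|]]]// hi].
    + by rewrite (_ : Ordinal hi = ord0) ?connect0//; apply/val_inj.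
    + by split; apply: connect1; apply/andP; split=> //; apply/asboolP => //; exact: share_edge_sym.
    + by split; apply: connect1; apply/andP; split=> //; apply/asboolP => //; exact: share_edge_sym.
  by move=> i j; exact: connect_trans (e0 i).2 (e0 j).1.
- rewrite /std_tricell /tricell -/o; apply/seteqP; split=> [v [[vl|vl]|vl]|v [[[|[|[|]]]// hi] _ vl]].
  + by exists (@Ordinal 3 0 isT).
  + by exists (@Ordinal 3 1 isT).
  + by exists (@Ordinal 3 2 isT).
  + by left; left.
  + by left; right.
  + by right.
Qed.

(* Makes the triangle inequality unnecessary: heights are additive. *)
Lemma dist_height p q : exists t, dist p q = height t p - height t q.
Proof.
have [u u0 [t ->]] := polar_surj q p.
by exists t; rewrite dist_polar ger0_norm// height_polar subrr cos0; ring.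
Qed.

(** Along the direction from [q] to [p], each point is at most [r] beyond its center, and the
    centers differ by at most |u|. *)
Lemma dist_regions y z u t p q : center z = polar (center y) u t ->
  region k r y p -> region k r z q -> dist p q <= `|u| + 2 * r.
Proof.
move=> zE yp zq; have [s ->] := dist_height p q.
have := region_height r0 s yp; have := region_height r0 (s + pi) zq.
rewrite !heightDpi zE height_polar.
have : - (u * cos (t - s)) <= `|u|.
  apply: le_trans (ler_norm _) _; rewrite normrN normrM.
  by rewrite ler_piMr// cos_max.
lra.
Qed.

(** The outer cells have the most distant centers: sin (d x) >= 1 / 2 makes 4 a sin (d x) at least 2
    a. *)
Lemma dist_std_tricell_le d p q : (2 * d <= k <= 6 * d)%N -> std_tricell d p -> std_tricell d q ->
  dist p q <= 4 * (r * cos x) * sin (d%:R * x) + 2 * r.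
Proof.
move=> dk; have s0 := sin_multiple_ge_half R k3 dk; have a0 := apothem_gt0 k3 r0.
have sub y z u t : center z = polar (center y) u t -> 
    `|u| <= 4 * (r * cos x) * sin (d%:R * x) ->
    forall p q, region k r y p -> region k r z q ->
    dist p q <= 4 * (r * cos x) * sin (d%:R * x) + 2 * r.
  move=> zE ul p' q' yp zq.
  by apply: le_trans (dist_regions zE yp zq) _; rewrite lerD2r.
have polarK c u t : polar (polar c u t) (- u) t = c.
  by rewrite polar_polar subrr polar0.
set o : @cell R := Cell (0, 0) 0.
have off := neighbor_offset k r o 0 d; rewrite add0n in off.
have self y p' q' := @sub y y 0 0 (esym (polar0 _ _)) ltac:(rewrite normr0; nra) p' q'.
have onb j := @sub o (nb o j) (2 * (r * cos x)) _ erefl ltac:(rewrite ger0_norm; nra).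
have nbo j := @sub (nb o j) o (- (2 * (r * cos x))) _ (esym (polarK _ _ _))
  ltac:(rewrite normrN ger0_norm; nra).
have nb2 := @sub (nb o 0) (nb o d) _ _ off ltac:(rewrite ger0_norm; nra).
have nb2' p' q' h h' := nb2 q' p' h' h.
move=> [[op|np]|np] [[oq|nq]|nq].
- exact: self op oq.
- exact: onb op nq.
- exact: onb op nq.
- exact: nbo np oq.
- exact: self np nq.
- exact: nb2 np nq.
- exact: nbo np oq.
- by rewrite distC; exact: nb2 nq np.
- exact: self np nq.
Qed.

Lemma dist_std_tricell_ge d : (2 * d <= k <= 6 * d)%N -> exists p q,
  [/\ std_tricell d p, std_tricell d q & dist p q = 4 * (r * cos x) * sin (d%:R * x) + 2 * (r * cos x)].
Proof.
move=> dk; have s0 := sin_multiple_ge_half R k3 dk; have a0 := apothem_gt0 k3 r0.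
set o : @cell R := Cell (0, 0) 0.
pose t := normal k o 0 + d%:R * x + pi / 2.
have off := neighbor_offset k r o 0 d; rewrite add0n -/t in off.
(* The far ends of the two outer inscribed discs on the line through their centers. *)
exists (polar (center (nb o d)) (r * cos x) t), (polar (center (nb o 0)) (- (r * cos x)) t).
split.
- by right; apply: region_disc => //; rewrite ger0_norm// ltW.
- by left; right; apply: region_disc => //; rewrite normrN ger0_norm// ltW.
rewrite off; set c := center _; set C := 4 * _ * _.
rewrite polar_polar (_ : polar c (C + _) t = polar (polar c (- (r * cos x)) t) (C + 2 * (r * cos x)) t).
  by rewrite dist_polar ger0_norm// /C; nra.
by rewrite polar_polar; congr polar; ring.
Qed.

(** A distant pair of points in the form with the larger index is carried to the other form, as
    preimages or as images under [f], where it exceeds the diameter bound. *)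
Lemma std_tricell_isometric_eq d d' f : (2 * d <= k <= 6 * d)%N -> (2 * d' <= k <= 6 * d')%N ->
  plane_isometry f -> f @` std_tricell d = std_tricell d' -> d = d'.
Proof.
move=> dk dk' fiso fE.
have gap e e' : (2 * e <= k <= 6 * e)%N -> (2 * e' <= k <= 6 * e')%N -> (e < e')%N ->
  4 * (r * cos x) * sin (e%:R * x) + 2 * r < 4 * (r * cos x) * sin (e'%:R * x) + 2 * (r * cos x).
  move=> /andP[ek ke] /andP[ek' ke'] ee'.
  have := sin_multiple_gap R k3 _ ee' ek'; rewrite -(ltr_pM2l r0) => /(_ ltac:(lia)); lra.
have [dd|dd|//] := ltngtP d d'.
- have [p [q [p' q' pq]]] := dist_std_tricell_ge dk'.
  move: p' q'; rewrite -fE => -[v vd vp] [w wd wq].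
  by have := dist_std_tricell_le dk vd wd; rewrite -fiso vp wq pq leNgt gap.
- have [p [q [pd qd pq]]] := dist_std_tricell_ge dk.
  have p' : std_tricell d' (f p) by rewrite -fE; exists p.
  have q' : std_tricell d' (f q) by rewrite -fE; exists q.
  by have := dist_std_tricell_le dk' p' q'; rewrite fiso pq leNgt gap.
Qed.

(** * Isomorphism classes and their number *)

Lemma isomorphic_refl P : isomorphic P P.
Proof. by exists id => //; rewrite image_id. Qed.

Lemma isomorphic_trans P Q (S : set (R * R)) : isomorphic P Q -> isomorphic Q S -> isomorphic P S.
Proof.
move=> [f fi <-] [g gi <-]; exists (g \o f); last by rewrite image_comp.
by move=> p q /=; rewrite gi fi.
Qed.

Lemma isomorphic_move c t P : isomorphic P (move c t @` P) /\ isomorphic (move c t @` P) P.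
Proof.
have [c' [mK _]] := moveK c t.
split; first by exists (move c t) => //; exact: dist_move.
exists (move c' (- t)); first exact: dist_move.
rewrite image_comp (_ : _ \o _ = id) ?image_id//.
by apply/funext => p /=; rewrite mK.
Qed.

Lemma polyomino_classes3 : polyomino_classes k r 3 =
  (fun d => [set Q | is_polyomino k r 3 Q /\ isomorphic (std_tricell d) Q]) @`
    [set d | (2 * d <= k <= 6 * d)%N].
Proof.
apply/seteqP; split=> [_ [P polyP <-]|_ [d dk <-]]; last first.
  by exists (std_tricell d) => //; exact: std_tricell_polyomino.
have [y [i [d [dk kd PE]]]] := polyomino3_tricell polyP.
exists d; first by rewrite /= dk kd.
have [c [t stdE]] := tricell_std y i d; rewrite -PE in stdE.
have [h1 h2] := isomorphic_move c t (std_tricell d); rewrite -stdE in h1 h2.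
apply/seteqP; split=> Q [polyQ h]; split=> //.
  exact: isomorphic_trans h2 h.
exact: isomorphic_trans h1 h.
Qed.

Lemma card_polyomino_classes3 :
  polyomino_classes k r 3 #= `I_(k %/ 2 - (k + 5) %/ 6 + 1)%N.
Proof.
set N := (_ + 1)%N.
(* [(k + 5) %/ 6] is the ceiling of k / 6, so the admissible [d] are the [N] integers from there up
   to [k %/ 2]. *)
rewrite polyomino_classes3 (_ : [set d | _] = (fun n => n + (k + 5) %/ 6)%N @` `I_N); last first.
  apply/seteqP; split=> [d /= dk|_ [n /= nN <-]]; last by rewrite /N in nN; lia.
  by exists (d - (k + 5) %/ 6)%N; rewrite /N /=; lia.
rewrite image_comp; apply: inj_card_eq => n m; rewrite !inE /N /= => nN mN e.
have dk : (2 * (n + (k + 5) %/ 6) <= k <= 6 * (n + (k + 5) %/ 6))%N by lia.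
have dk' : (2 * (m + (k + 5) %/ 6) <= k <= 6 * (m + (k + 5) %/ 6))%N by lia.
(* If the classes coincide, the standard form of one belongs to the class of the other. *)
have : [set Q | is_polyomino k r 3 Q /\ isomorphic (std_tricell (n + (k + 5) %/ 6)) Q]
    (std_tricell (m + (k + 5) %/ 6)).
  by rewrite e; split; [exact: std_tricell_polyomino|exact: isomorphic_refl].
move=> [_ [f fi fE]]; apply/eqP; rewrite -(eqn_add2r ((k + 5) %/ 6)); apply/eqP.
exact: std_tricell_isometric_eq fi fE.
Qed.

End Tricells.

Theorem theorem3 (R : realType) (k : nat) (r : R)
  (hk : (3 <= k)%N) (hr : (0 < r)%R) :
  polyomino_classes k r 3 #= `I_(k %/ 2 - (k + 5) %/ 6 + 1)%N.
Proof. exact: card_polyomino_classes3. Qed.
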